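(* Let $p\in[1,\infty)$, $s\in(0,1)$, $N\in\mathbb{N}$, and let $\{\rho_\varepsilon\}_{\varepsilon>0}$ be a family of non-negative measurable kernels $\rho_\varepsilon:\mathbb{R}^N\to[0,\infty)$ satisfying $$\lim_{R\to\infty}\lim_{\varepsilon\to0}\int_{|z|>R}\rho_\varepsilon(z)\,dz=1\quad\text{and}\quad \lim_{R\to\infty}\lim_{\varepsilon\to0}\int_{|z|<R}|z|^{sp}\rho_\varepsilon(z)\,dz=0.$$ Then, for every $u\in W^{s,p}(\mathbb{R}^N)$, $$\lim_{\varepsilon\to0}\mathcal{F}_\varepsilon(u)=2\|u\|_{L^p(\mathbb{R}^N)}^p.$$ Moreover, for every $u\in W^{s,p}(\mathbb{R}^N)$ and each $R>0$, $$\lim_{\varepsilon\to0}\int_{|z|<R}\int_{\mathbb{R}^N}\rho_\varepsilon(z)\,|u(x+z)-u(x)|^p\,dx\,dz=0.$$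
   Context: For a measurable function $u$ on $\mathbb{R}^N$ the nonlocal energy is $$\mathcal{F}_\varepsilon(u):=\iint_{\mathbb{R}^N\times\mathbb{R}^N}\rho_\varepsilon(y-x)\,|u(x)-u(y)|^p\,dx\,dy\in[0,+\infty].$$ Integrals of non-negative functions take values in $[0,+\infty]$. $W^{s,p}(\mathbb{R}^N)$ is the fractional Sobolev space of all $u\in L^p(\mathbb{R}^N)$ with $[u]_{W^{s,p}}^p:=\iint_{\mathbb{R}^N\times\mathbb{R}^N}\frac{|u(x)-u(y)|^p}{|x-y|^{N+sp}}\,dx\,dy<\infty$, with norm $\|u\|_{W^{s,p}}:=\|u\|_{L^p}+[u]_{W^{s,p}}$. *)

(* Defs.v *)
From HB Require Import structures.
From mathcomp Require Import all_boot all_order all_algebra.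
From mathcomp Require Import all_classical all_reals all_analysis.
From mathcomp Require Import measurable_realfun.

Set Implicit Arguments.
Unset Strict Implicit.
Unset Printing Implicit Defensive.
Import Order.TTheory GRing.Theory Num.Theory.
Import numFieldNormedType.Exports.
Local Open Scope classical_set_scope.
Local Open Scope ring_scope.

(* The Borel sigma-algebra of R^n, generated by the coordinate functions. *)
Section borel_rV.
Variables (R : realType) (n : nat).

Let coord (i : 'I_n) (x : 'rV[R]_n) : measurableTypeR R := x 0 i.

Let rV_set0 : g_sigma_preimage coord set0.
Proof. exact: sigma_algebra0. Qed.

Let rV_setC A : g_sigma_preimage coord A -> g_sigma_preimage coord (~` A).
Proof. exact: sigma_algebraC. Qed.

Let rV_bigcup (F : (set 'rV[R]_n)^nat) :
  (forall i, g_sigma_preimage coord (F i)) ->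
  g_sigma_preimage coord (\bigcup_i (F i)).
Proof. exact: sigma_algebra_bigcup. Qed.

HB.instance Definition _ := @isMeasurable.Build default_measure_display
  'rV[R]_n (g_sigma_preimage coord) rV_set0 rV_setC rV_bigcup.

Lemma measurable_coord_rV (i : 'I_n) :
  measurable_fun [set: 'rV[R]_n] (fun x => x 0 i : measurableTypeR R).
Proof.
move=> _ Y mY; rewrite setTI; apply: sub_sigma_algebra => /=.
rewrite -bigcup_seq/=; exists i => /=; first by rewrite mem_index_enum.
by exists Y => //; rewrite setTI.
Qed.

Lemma measurable_fun_rV d (T : measurableType d) (f : T -> 'rV[R]_n) :
  (forall i, measurable_fun [set: T] (fun t => f t 0 i : measurableTypeR R)) ->
  measurable_fun [set: T] f.
Proof.
move=> mf _ Y mY; rewrite setTI.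
pose G := [set A : set 'rV[R]_n | measurable (f @^-1` A)].
suff : g_sigma_preimage coord `<=` G by apply.
apply: smallest_sub.
  split; rewrite /G /=.
  - by rewrite preimage_set0.
  - by move=> A mA; rewrite setTD -preimage_setC; exact: measurableC.
  - by move=> F mF; rewrite preimage_bigcup; exact: bigcupT_measurable.
rewrite -bigcup_seq => _ [i _ [A mA <-]]; rewrite /G /= setTI.
by have := mf i measurableT _ mA; rewrite setTI.
Qed.

End borel_rV.

Section lebesgue_rV.
Variable R : realType.

Definition cons_rV n (x : measurableTypeR R * 'rV[R]_n) : 'rV[R]_n.+1 :=
  row_mx (x.1%:M : 'rV[R]_1) x.2.

Lemma cons_rV0 n (x : measurableTypeR R * 'rV[R]_n) : cons_rV x 0 0 = x.1.
Proof. rewrite /cons_rV (_ : (0 : 'I_n.+1) = lshift n (0 : 'I_1)); last exact/val_inj.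
by rewrite (row_mxEl (x.1%:M : 'rV[R]_1)) mxE. Qed.

Lemma cons_rVS n (x : measurableTypeR R * 'rV[R]_n) (j : 'I_n) :
  cons_rV x 0 (lift 0 j) = x.2 0 j.
Proof. by rewrite /cons_rV -rshift1 (row_mxEr (x.1%:M : 'rV[R]_1)). Qed.

Lemma measurable_cons_rV n : measurable_fun setT (@cons_rV n).
Proof.
apply: measurable_fun_rV => i; have [j ->|->] := unliftP 0 i.
  rewrite (_ : (fun t => _) =
    (fun v : 'rV[R]_n => v 0 j : measurableTypeR R) \o snd).
    exact: (measurableT_comp (measurable_coord_rV j) measurable_snd).
  by apply/funext => x; rewrite cons_rVS.
rewrite (_ : (fun t => _) = fst); first exact: measurable_fst.
by apply/funext => x; rewrite cons_rV0.
Qed.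

Section step.
Variables (n : nat) (m : {sigma_finite_measure set 'rV[R]_n -> \bar R}).

Definition lebesgue_step : set 'rV[R]_n.+1 -> \bar R :=
  pushforward (@lebesgue_measure R \x m)%E (@cons_rV n).

Let mcons (A : set 'rV[R]_n.+1) : measurable A ->
  measurable (@cons_rV n @^-1` A).
Proof. by rewrite -[X in _ -> measurable X]setTI; exact: measurable_cons_rV. Qed.

Let step0 : lebesgue_step set0 = 0%E.
Proof. by rewrite /lebesgue_step /pushforward preimage_set0 measure0. Qed.

Let step_ge0 A : (0 <= lebesgue_step A)%E.
Proof. by rewrite /lebesgue_step /pushforward; exact: measure_ge0. Qed.

Let step_sigma_additive : semi_sigma_additive lebesgue_step.
Proof.
move=> F mF tF mUF; rewrite /lebesgue_step /pushforward preimage_bigcup.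
apply: measure_semi_sigma_additive.
- by move=> k; exact: mcons.
- apply/trivIsetP => /= i j _ _ ij; rewrite -preimage_setI.
  by move/trivIsetP : tF => /(_ _ _ _ _ ij) ->//; rewrite preimage_set0.
- by rewrite -preimage_bigcup; exact: mcons.
Qed.

HB.instance Definition _ := isMeasure.Build _ _ _ lebesgue_step
  step0 step_ge0 step_sigma_additive.

Let uncons (x : 'rV[R]_n.+1) : measurableTypeR R * 'rV[R]_n :=
  (x 0 0, \row_j x 0 (lift 0 j)).

Let unconsK : cancel uncons (@cons_rV n).
Proof.
move=> x; apply/rowP => i; have [j ->|->] := unliftP 0 i.
  by rewrite cons_rVS mxE.
by rewrite cons_rV0.
Qed.

Let cons_rVK : cancel (@cons_rV n) uncons.
Proof.
move=> [a v]; congr pair => /=; first by rewrite cons_rV0.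
by apply/rowP => j; rewrite mxE cons_rVS.
Qed.

Let muncons : measurable_fun setT uncons.
Proof.
apply/measurable_fun_pairP; split; first exact: measurable_coord_rV.
apply: measurable_fun_rV => j.
rewrite (_ : (fun t => _) =
  (fun x : 'rV[R]_n.+1 => x 0 (lift 0 j) : measurableTypeR R)).
  exact: measurable_coord_rV.
by apply/funext => x /=; rewrite mxE.
Qed.

Let step_sigma_finite : sigma_finite setT lebesgue_step.
Proof.
have /sigma_finiteP[F [TF ndF Foo]] := sigma_finiteT (@lebesgue_measure R).
have /sigma_finiteP[G [TG ndG Goo]] := sigma_finiteT m.
exists (fun k => uncons @^-1` (F k `*` G k)).
  rewrite predeqE => x; split => // _.
  have [i _ Fi] : (\bigcup_k F k) (uncons x).1 by rewrite -TF.
  have [j _ Gj] : (\bigcup_k G k) (uncons x).2 by rewrite -TG.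
  exists (maxn i j) => //; split.
    by move: Fi; exact/subsetPset/ndF/leq_maxl.
  by move: Gj; exact/subsetPset/ndG/leq_maxr.
move=> k; have [mF Fk] := Foo k; have [mG Gk] := Goo k; split.
  by rewrite -[X in measurable X]setTI; apply: muncons => //; exact: measurableX.
rewrite /lebesgue_step /pushforward -comp_preimage.
rewrite (_ : uncons \o _ = id); last by apply/funext => x; exact: cons_rVK.
by rewrite preimage_id product_measure1E// lte_mul_pinfty// ge0_fin_numE.
Qed.

HB.instance Definition _ := Measure_isSigmaFinite.Build _ _ _ lebesgue_step
  step_sigma_finite.

End step.

(* Lebesgue measure on the Borel sets of R^n, as the n-fold product of the
   one-dimensional one. *)
Fixpoint lebesgue_rV n : {sigma_finite_measure set 'rV[R]_n -> \bar R} :=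
  match n with
  | 0 => dirac (0 : 'rV[R]_0)
  | n'.+1 => lebesgue_step (lebesgue_rV n')
  end.

Lemma lebesgue_rV_box n (A : 'I_n -> set (measurableTypeR R)) :
  (forall i, measurable (A i)) ->
  lebesgue_rV n [set x : 'rV[R]_n | forall i, A i (x 0 i)] =
  (\prod_(i < n) lebesgue_measure (A i))%E.
Proof.
elim: n A => [|n IH] A mA.
  rewrite big_ord0 /= diracE mem_set//= => -[] //.
rewrite big_ord_recl /= -IH; last by move=> i; exact: mA.
rewrite /lebesgue_step /pushforward -product_measure1E//=.
  congr (_ _); apply/seteqP; split => [[a v] /= Aav|[a v] /= [Aa Av] i].
    split; first by have := Aav 0; rewrite cons_rV0.
    by move=> i; have := Aav (lift 0 i); rewrite cons_rVS.
  by have [j ->|->] := unliftP 0 i; rewrite ?cons_rVS ?cons_rV0.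
rewrite (_ : [set _ | _] = \bigcap_(i in [set: 'I_n])
  ((fun x : 'rV[R]_n => x 0 i : measurableTypeR R) @^-1` A (lift 0 i))).
  apply: fin_bigcap_measurable => // i _.
  by rewrite -[X in measurable X]setTI; exact: measurable_coord_rV.
by apply/seteqP; split => [x Ax i _|x Ax i]; apply: Ax.
Qed.

End lebesgue_rV.

Section lebesgue_integral_of_completion.
Import HBNNSimple.

(* The library integral of a nonnegative function f is the supremum of the
   integrals of the (Borel) simple functions below f. It makes sense for every
   f, and for f measurable with respect to the completion of mu (that is, equal
   almost everywhere to a Borel function g) it is the Lebesgue integral: *)
Lemma ge0_integral_ae d (T : measurableType d) (R : realType)
    (mu : {measure set T -> \bar R}) (f g : T -> \bar R) :
  (forall x, 0 <= f x)%E -> (forall x, 0 <= g x)%E ->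
  measurable_fun [set: T] g -> {ae mu, forall x, f x = g x} ->
  (\int[mu]_x f x = \int[mu]_x g x)%E.
Proof.
move=> f0 g0 mg [Z [mZ Z0 fgZ]].
have fgE x : ~ Z x -> f x = g x by apply: contra_notP => fgx; exact: fgZ.
have NZ h : (forall x, 0 <= h x)%E -> measurable_fun [set: T] h ->
    (\int[mu]_x h x = \int[mu]_(x in [set: T] `\` Z) h x)%E.
  by move=> h0 mh; exact: ge0_negligible_integral.
have mNZ : measurable ([set: T] `\` Z) by exact: measurableD.
apply/eqP; rewrite eq_le; apply/andP; split.
  rewrite [leLHS]ge0_integralTE//; apply: ge_ereal_sup => _ [h hf <-].
  have -> : sintegral mu h = (\int[mu]_x (h x)%:E)%E.
    by rewrite integral_nnsfun// patch_setT.
  have h0 x : (0 <= (h x)%:E)%E by rewrite lee_fin.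
  have mh : measurable_fun [set: T] (fun x => (h x)%:E).
    exact/measurable_EFinP.
  rewrite (NZ _ h0 mh) (NZ _ g0 mg); apply: ge0_le_integral => //.
  - exact: measurable_funS mh.
  - exact: measurable_funS mg.
  - by move=> x [_ NZx]; rewrite -fgE//; exact: hf.
rewrite NZ// integral_mkcond [leLHS]ge0_integralTE; last first.
  by move=> x; rewrite patchE; case: ifP.
rewrite [leRHS]ge0_integralTE//; apply: ereal_sup_le => _ [h hg <-].
exists h => // x.
apply: le_trans (hg x) _; rewrite patchE; case: ifPn => // xZ.
by rewrite fgE//; move: xZ; rewrite inE => -[].
Qed.

End lebesgue_integral_of_completion.

Section fractional_Sobolev.
Variables (R : realType) (N : nat).
Local Notation lambda := (lebesgue_rV R N).

(* The norm `|x| which the library puts on 'rV[R]_N is the sup norm. *)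
Definition enorm (x : 'rV[R]_N) : R := Num.sqrt (\sum_(i < N) x 0 i ^+ 2).

(* Measurability for the Lebesgue sigma-algebra: preimages of Borel sets are
   unions of a Borel set and a Lebesgue-negligible set. *)
Definition lebesgue_measurable_fun (f : 'rV[R]_N -> R) : Prop :=
  forall B : set R, measurable B -> completed_algebra_gen lambda (f @^-1` B).

(* This is [u]^p, the p-th power of the seminorm; the integrand is 0 on the
   diagonal, for 0 / 0 = 0. *)
Definition gagliardo (s p : R) (u : 'rV[R]_N -> R) : \bar R :=
  (\int[lambda \x lambda]_xy
     (`|u xy.1 - u xy.2| `^ p / enorm (xy.1 - xy.2) `^ (N%:R + s * p))%:E)%E.

Definition Wsp (s p : R) : set ('rV[R]_N -> R) :=
  [set u | [/\ lebesgue_measurable_fun u,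
               ('N[lambda]_p%:E[EFin \o u] < +oo)%E &
               (gagliardo s p u < +oo)%E]].

Definition nonlocal_energy (p : R) (rho : 'rV[R]_N -> R) (u : 'rV[R]_N -> R) :
    \bar R :=
  (\int[lambda \x lambda]_xy
     (rho (xy.2 - xy.1) * `|u xy.1 - u xy.2| `^ p)%:E)%E.

End fractional_Sobolev.

(* lim_(r -> +oo) lim_(e -> 0+) f r e = l, where the inner limit is asked to
   exist, in \bar R, for all large r. *)
Definition iterated_lim (R : realType) (f : R -> R -> \bar R) (l : \bar R) :=
  exists L : R -> \bar R,
    (\forall r \near +oo%R, f r e @[e --> 0^'+] --> L r) /\
    L r @[r --> +oo%R] --> l.

(* Main.v *)
(** Write w(z) for the integral of |u(x + z) - u(x)|^p dx. By Tonelli and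
    translation invariance the energy is the integral of rho_e w, and [u]^p is
    that of w / |z|^(N + sp). Two facts on w give the theorem.
    Near 0: w(h) <= 2^p (w(z) + w(z - h)), and averaging over z in the cube of
    side |h| centred at h / 2 gives w(h) <= K |h|^(sp), so that the mass of
    rho_e w on a ball is at most K times that of |z|^(sp) rho_e.
    Near infinity: w(z) tends to 2 ||u||_p^p, because the translates of a
    truncation of u have disjoint supports; hence the mass of rho_e w far away
    is about 2 ||u||_p^p times that of rho_e. *)
From HB Require Import structures.
Require Import Defs.
From mathcomp Require Import all_boot all_order all_algebra.
From mathcomp Require Import all_classical all_reals all_analysis.
From mathcomp Require Import measurable_realfun ring lra.
Set Implicit Arguments.
Unset Strict Implicit.
Unset Printing Implicit Defensive.
Import Order.TTheory GRing.Theory Num.Theory.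
Import numFieldNormedType.Exports.
Local Open Scope classical_set_scope.
Local Open Scope ring_scope.
Local Open Scope ereal_scope.

(** * Translation invariance of the Lebesgue measure *)

(** The seminorm controls w only on average, while the mass of rho_e w near 0 calls for a bound at
    every z, since a kernel may concentrate anywhere; hence the averaging. Cubes replace balls
    because the measure is a product and gives their volume at once; passing from coordinates to the
    Euclidean norm then costs a power of sqrt N. At infinity the comparison is made on w^(1/p), the
    L^p norm of an increment: Minkowski bounds the truncation error there uniformly in z, and the
    p-th power is taken back only at the end. Both facts on w depend on u alone, so they serve all
    kernels at once, and a radius can be fixed before e tends to 0. The other obstacle is
    measurability: u and rho_e are Lebesgue measurable, whereas Tonelli is applied to Borel
    functions. Each function is replaced by a Borel representative, and null sets are pulled back to
    the product along x, y and y - x. *)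

Section measure_preserving.
Context {d : measure_display} {T : measurableType d} {R : realType}.
Variables (mu : {measure set T -> \bar R}) (phi : T -> T).
Hypothesis mphi : measurable_fun [set: T] phi.
Let mphi_mixin := isMeasurableFun.Build _ _ _ _ _ mphi.
Let mphi_pack : {mfun _ >-> _} := HB.pack phi mphi_mixin.

Lemma ge0_integral_measure_preserving (f : T -> \bar R) :
  (forall A, measurable A -> mu (phi @^-1` A) = mu A) ->
  measurable_fun [set: T] f -> (forall x, 0 <= f x) ->
  \int[mu]_x f (phi x) = \int[mu]_x f x.
Proof.
move=> muphi mf f0.
rewrite -[LHS]/(\int[mu]_(x in mphi_pack @^-1` setT) (f \o mphi_pack) x).
rewrite -ge0_integral_pushforward//.
by apply: eq_measure_integral => A mA _; exact: muphi.
Qed.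

End measure_preserving.

Section translation.
Context {R : realType}.

Section shift.
Variable a : R.
Let shift (x : measurableTypeR R) : measurableTypeR R := (x + a)%R.
Let mshift : measurable_fun setT shift.
Proof. exact: measurable_funD. Qed.
Let mshift_mixin := isMeasurableFun.Build _ _ _ _ _ mshift.
Let mshift_pack : {mfun _ >-> _} := HB.pack shift mshift_mixin.

Lemma ge0_integral_lebesgueD (f : measurableTypeR R -> \bar R) :
  measurable_fun setT f -> (forall x, 0 <= f x) ->
  \int[@lebesgue_measure R]_x f (x + a)%R = \int[@lebesgue_measure R]_x f x.
Proof.
move=> mf f0.
rewrite -(ge0_integral_measure_preserving mshift _ mf f0)// => A mA.
rewrite -[LHS]/(pushforward lebesgue_measure mshift_pack A).
(* By uniqueness of the Lebesgue measure it suffices to compare half-open intervals, whose length a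
   shift preserves. *)
apply/esym/lebesgue_measure_unique => //= _ [[b c]] _ <-.
rewrite /pushforward.
rewrite (_ : _ @^-1` _ = `](b - a)%R, (c - a)%R]%classic); last first.
  by apply/seteqP; split => x /=; rewrite /shift !in_itv/= ltrBlDr lerBrDr.
by rewrite !lebesgue_measure_itv/= !lte_fin ltrD2r -!EFinB opprB addrA subrK.
Qed.
End shift.

Lemma cons_rVD n (a : 'rV[R]_n.+1) (t : R) (v : 'rV[R]_n) :
  (cons_rV (t, v) + a = cons_rV (t + a 0 0, v + \row_j a 0 (lift 0 j)))%R.
Proof.
apply/rowP => i; rewrite mxE; have [j ->|->] := unliftP ord0 i.
  by rewrite !cons_rVS !mxE.
by rewrite !cons_rV0.
Qed.

(** The measure in dimension n + 1 is by construction the pushforward of a product under [cons_rV],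
    so Tonelli applies; this carries inductions on the dimension. *)
Lemma ge0_integral_lebesgue_rVS n (f : 'rV[R]_n.+1 -> \bar R) :
  measurable_fun setT f -> (forall x, 0 <= f x) ->
  \int[lebesgue_rV R n.+1]_x f x =
  \int[@lebesgue_measure R]_t \int[lebesgue_rV R n]_v f (cons_rV (t, v)).
Proof.
move=> mf f0.
rewrite -(@fubini_tonelli1 _ _ _ _ _ _ _ (f \o @cons_rV R n))//; first last.
- by move=> x; exact: f0.
- exact: measurableT_comp mf (@measurable_cons_rV R n).
pose mix := isMeasurableFun.Build _ _ _ _ _ (@measurable_cons_rV R n).
pose phi : {mfun _ >-> _} := HB.pack (@cons_rV R n) mix.
rewrite -[RHS]/(\int[_]_(x in phi @^-1` setT) (f \o phi) x).
rewrite -ge0_integral_pushforward//.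
Qed.

Lemma measurable_funD_rV n d (T : measurableType d) (f g : T -> 'rV[R]_n) :
  measurable_fun setT f -> measurable_fun setT g ->
  measurable_fun setT (fun x => f x + g x)%R.
Proof.
move=> mf mg; apply: measurable_fun_rV => i.
rewrite (_ : (fun _ => _) = (fun t => f t 0 i + g t 0 i)%R); last first.
  by apply/funext => t; rewrite mxE.
apply: measurable_funD.
  exact: measurableT_comp (measurable_coord_rV i) mf.
exact: measurableT_comp (measurable_coord_rV i) mg.
Qed.

Lemma measurable_funN_rV n d (T : measurableType d) (f : T -> 'rV[R]_n) :
  measurable_fun setT f -> measurable_fun setT (fun x => - f x)%R.
Proof.
move=> mf; apply: measurable_fun_rV => i.
rewrite (_ : (fun _ => _) = (fun t => - f t 0 i)%R); last first.
  by apply/funext => t; rewrite mxE.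
apply: measurableT_comp => //.
exact: measurableT_comp (measurable_coord_rV i) mf.
Qed.

(** Induction on n: a shift acts separately on the head and on the tail of a vector. The tail is
    handled inside by the induction hypothesis, the head by the one-dimensional case. *)
Lemma ge0_integral_rVD n (a : 'rV[R]_n) (f : 'rV[R]_n -> \bar R) :
  measurable_fun setT f -> (forall x, 0 <= f x) ->
  \int[lebesgue_rV R n]_x f (x + a)%R = \int[lebesgue_rV R n]_x f x.
Proof.
elim: n a f => [|n IH] a f mf f0.
  by apply: eq_integral => x _; congr f; apply/rowP => -[].
have mfa : measurable_fun setT (fun x : 'rV[R]_n.+1 => f (x + a)%R).
  by apply: measurableT_comp => //; exact: measurable_funD_rV.
rewrite (ge0_integral_lebesgue_rVS mf f0).
rewrite (ge0_integral_lebesgue_rVS mfa (fun=> f0 _)).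
have mfc t : measurable_fun setT (fun v => f (cons_rV (t, v))).
  apply: measurableT_comp mf _.
  exact: measurableT_comp (@measurable_cons_rV R n) (measurable_pair1 t).
under eq_integral => t _.
  under eq_integral do rewrite cons_rVD.
  rewrite (IH (\row_j a 0 (lift 0 j))%R
    (fun v => f (cons_rV (t + a 0 0, v)%R)))//.
  over.
apply: (ge0_integral_lebesgueD (a 0 0)%R
  (f := fun t => \int[lebesgue_rV R n]_v f (cons_rV (t, v)))).
  apply: (@measurable_fun_fubini_tonelli_F _ _ _ _ _ _
    (f \o @cons_rV R n)) => //=.
  exact: measurableT_comp mf (@measurable_cons_rV R n).
by move=> t; apply: integral_ge0.
Qed.

End translation.
(** * Borel representatives *)

Section completion.
Context {d : measure_display} {T : measurableType d} {R : realType}.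
Variable mu : {measure set T -> \bar R}.

(* Countably many rays with rational end points generate the Borel sets of R,
   so one negligible set Z absorbs all the non-Borel parts. *)
Lemma completed_measurable_ae_borel (f : T -> R) :
  (forall B : set R, measurable B -> completed_algebra_gen mu (f @^-1` B)) ->
  exists Z, [/\ measurable Z, mu Z = 0 &
    measurable_fun [set: T] (fun x => if x \in Z then 0%R else f x)].
Proof.
move=> mf.
pose ray (q : rat) : set R := `]ratr q, +oo[%classic.
have /choice[W hW] : forall q : rat, exists AZ : set T * set T,
    [/\ measurable AZ.1, measurable AZ.2, mu AZ.2 = 0,
        AZ.1 `<=` f @^-1` ray q & f @^-1` ray q `<=` AZ.1 `|` AZ.2].
  move=> q; have [A mA [N [Z [mZ Z0 NZ]] AN]] := mf (ray q) (measurable_itv _).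
  exists (A, Z); split => //=; first by rewrite -AN; exact: subsetUl.
  by rewrite -AN; exact: setUS.
pose F k := if unpickle k is Some q then (W q).2 else set0.
pose Z := \bigcup_k F k.
have mF k : measurable (F k).
  by rewrite /F; case: unpickle => // q; have [] := hW q.
have mZ : measurable Z by exact: bigcupT_measurable.
have Z0 : mu Z = 0.
  apply/(negligibleP _ _).1 => //; apply: negligible_bigcup => k.
  apply/(negligibleP _ (mF k)); rewrite /F; case: unpickle => [q|].
    by have [] := hW q.
  exact: measure0.
have WZ q : (W q).2 `<=` Z.
  move=> x Wx; exists (pickle q); first exact: Logic.I.
  by rewrite /F pickleK; exact: Wx.
exists Z; split => //.
apply: (measurability _ (RGenOInfty.measurableE R)) => //= _ [_ [c ->] <-].
rewrite setTI.
(* Off Z, a value above c exceeds some rational q > c, so the point lies in the Borel part of that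
   ray. On Z the value is 0, so Z is included exactly when c < 0. *)
have -> : (fun x => if x \in Z then 0%R else f x) @^-1` `]c, +oo[%classic =
    (Z `&` [set _ | (c < 0)%R]) `|`
    ((\bigcup_(q in [set q : rat | (c < ratr q)%R]) (W q).1) `\` Z).
  apply/seteqP; split => [x /=|x /= [[Zx c0]|[[q cq Wx] Zx]]];
    rewrite in_itv/= andbT.
  - case: ifPn => [/set_mem Zx c0|/negP Zx cf]; first by left.
    right; split; last by move=> Zx'; apply: Zx; exact: mem_set.
    have [q] := rat_in_itvoo cf.
    rewrite in_itv/= => /andP[cq qf]; exists q => //.
    have [_ _ _ _ /(_ x)] := hW q.
    rewrite /ray/= in_itv/= qf => /(_ isT)[//|].
    by move=> /WZ Zx'; case: Zx; exact: mem_set.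
  - by rewrite mem_set.
  - rewrite memNset//; have [_ _ _ + _] := hW q => /(_ _ Wx).
    by rewrite /ray/= in_itv/= andbT; exact: lt_trans.
apply: measurableU.
  apply: measurableI => //; have [c0|c0] := pselect (c < 0)%R.
    by rewrite (_ : [set _ | _] = setT)//; apply/seteqP; split.
  by rewrite (_ : [set _ | _] = set0)//; apply/seteqP; split.
apply: measurableD => //.
rewrite bigcup_mkcond.
apply: countable_bigcupT_measurable => [|q]; first exact: countableP.
by case: ifP => // _; have [] := hW q.
Qed.
End completion.
(** * The integral modulus of continuity *)

Section modulus.
Context {R : realType} {N : nat}.
Local Notation V := ('rV[R]_N).
Local Notation lambda := (lebesgue_rV R N).

Definition modulus (p : R) (u : V -> R) (z : V) : \bar R :=
  \int[lambda]_x (`|u (x + z) - u x| `^ p)%:E.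

Lemma modulus_ge0 p u z : 0 <= modulus p u z.
Proof. by apply: integral_ge0 => x _; rewrite lee_fin powR_ge0. Qed.

Lemma modulus0 p u : (p != 0)%R -> modulus p u 0%R = 0.
Proof.
move=> p0; rewrite /modulus.
under eq_integral do rewrite addr0 subrr normr0 powR0//.
exact: integral0.
Qed.

Lemma measurable_powR_norm d (T : measurableType d) (f : T -> R) (p : R) :
  measurable_fun setT f -> measurable_fun setT (fun x => (`|f x| `^ p)%R).
Proof.
move=> mf; apply: (measurableT_comp (measurable_powR _)).
exact: measurableT_comp.
Qed.

Section borel.
Variable u : V -> R.
Hypothesis mu : measurable_fun setT u.

Lemma measurable_increment (p : R) : measurable_fun setT
  (fun xz : V * V => (`|u (xz.1 + xz.2) - u xz.1| `^ p)%:E).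
Proof.
apply/measurable_EFinP/measurable_powR_norm/measurable_funB.
  by apply: (measurableT_comp mu); exact: measurable_funD_rV.
exact: measurableT_comp.
Qed.

Lemma measurable_modulus p : measurable_fun setT (modulus p u).
Proof.
apply: (@measurable_fun_fubini_tonelli_G _ _ _ _ _ lambda _
  (measurable_increment p)).
by move=> x; rewrite lee_fin powR_ge0.
Qed.

(** Tonelli, the substitution y = x + z at fixed x, then Tonelli again. It is used twice: with k a
    Borel version of rho_e for the energy, and with k the singular weight for the seminorm. *)
Lemma double_integral_modulus (p : R) (k : V -> R) :
  measurable_fun setT k -> (forall z, 0 <= k z)%R ->
  \int[lambda \x lambda]_xy
     (k (xy.2 - xy.1) * `|u xy.1 - u xy.2| `^ p)%:E =
  \int[lambda]_z ((k z)%:E * modulus p u z).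
Proof.
move=> mk k0.
have msub : measurable_fun setT (fun xy : V * V => xy.2 - xy.1)%R.
  by apply: measurable_funD_rV => //; exact: measurable_funN_rV.
have mF : measurable_fun setT (fun xy : V * V =>
    (k (xy.2 - xy.1) * `|u xy.1 - u xy.2| `^ p)%:E).
  apply/measurable_EFinP/measurable_funM; first exact: measurableT_comp mk msub.
  by apply/measurable_powR_norm/measurable_funB; exact: measurableT_comp.
rewrite fubini_tonelli1//; last first.
  by move=> x; rewrite lee_fin mulr_ge0// powR_ge0.
pose G (xz : V * V) := ((k xz.2)%:E * (`|u (xz.1 + xz.2) - u xz.1| `^ p)%:E).
transitivity (\int[lambda]_x \int[lambda]_z G (x, z)).
  apply: eq_integral => x _; rewrite /fubini_F /=.
  rewrite -(ge0_integral_rVD x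
    (f := fun y => (k (y - x) * `|u x - u y| `^ p)%:E)).
  - by apply: eq_integral => z _; rewrite /G /= addrK EFinM distrC (addrC z).
  - exact: measurableT_comp mF (measurable_pair1 x).
  - by move=> y; rewrite lee_fin mulr_ge0// powR_ge0.
rewrite (@fubini_tonelli _ _ _ _ _ _ _ G).
- apply: eq_integral => z _; rewrite /G /= ge0_integralZl//.
  + exact: measurableT_comp (measurable_increment p) (measurable_pair2 z).
  + by rewrite lee_fin k0.
- apply: emeasurable_funM; last exact: measurable_increment.
  by apply/measurable_EFinP; exact: measurableT_comp.
- by move=> x; rewrite mule_ge0// lee_fin// powR_ge0.
Qed.

End borel.
End modulus.

(** * The Euclidean norm and the volume of cubes *)

Section enorm.
Context {R : realType} {N : nat}.
Implicit Types x : 'rV[R]_N.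
Local Open Scope ring_scope.

Lemma enorm_ge0 x : 0 <= enorm x.
Proof. exact: sqrtr_ge0. Qed.

Lemma enormN x : enorm (- x) = enorm x.
Proof. by congr Num.sqrt; apply: eq_bigr => i _; rewrite mxE sqrrN. Qed.

Lemma ler_coord_enorm x i : `|x 0 i| <= enorm x.
Proof.
rewrite -sqrtr_sqr ler_wsqrtr// (bigD1 i)//= lerDl.
by apply: sumr_ge0 => j _; exact: sqr_ge0.
Qed.

Lemma enorm_eq0 x : enorm x = 0 -> x = 0.
Proof.
move=> x0; apply/rowP => i; rewrite mxE; apply/eqP; rewrite -normr_le0 -x0.
exact: ler_coord_enorm.
Qed.

Lemma enorm_gt0 x : x != 0 -> 0 < enorm x.
Proof.
move=> x0; rewrite lt_neqAle enorm_ge0 andbT eq_sym.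
by apply: contraNneq x0 => /enorm_eq0 ->.
Qed.

Lemma ler_enorm_sqrt x (l : R) : 0 <= l -> (forall i, `|x 0 i| <= l) ->
  enorm x <= Num.sqrt N%:R * l.
Proof.
move=> l0 xl; rewrite -[l in leRHS]ger0_norm// -sqrtr_sqr -sqrtrM//.
rewrite ler_wsqrtr// mulr_natl -[X in _ *+ X](card_ord N) -sumr_const.
by apply: ler_sum => i _; rewrite -real_normK ?num_real// lerXn2r ?nnegrE.
Qed.

Lemma measurable_enorm : measurable_fun setT (@enorm R N).
Proof.
apply: (measurableT_comp (continuous_measurable_fun (@sqrt_continuous R))).
apply: measurable_sum => i; apply: measurable_funX; exact: measurable_coord_rV.
Qed.

Lemma measurable_box (c : 'rV[R]_N) (l : R) :
  measurable [set x : 'rV[R]_N | forall i, `|x 0 i - c 0 i| <= l].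
Proof.
rewrite (_ : [set _ | _] = \bigcap_(i in [set: 'I_N])
  ((fun x : 'rV[R]_N => x 0 i : measurableTypeR R) @^-1`
    `[c 0 i - l, c 0 i + l])).
  apply: fin_bigcap_measurable => // i _.
  by rewrite -[X in measurable X]setTI; exact: measurable_coord_rV.
by apply/seteqP; split => [x xl i _|x xl i]; first move: (xl i);
  [|move: (xl i Logic.I)]; rewrite /= in_itv/= ler_distl.
Qed.

Lemma lebesgue_rV_cube (c : 'rV[R]_N) (l : R) : 0 <= l ->
  lebesgue_rV R N [set x : 'rV[R]_N | forall i, `|x 0 i - c 0 i| <= l] =
  ((l *+ 2) ^+ N)%:E.
Proof.
move=> l0.
pose A i : set (measurableTypeR R) := `[c 0 i - l, c 0 i + l]%classic.
rewrite (_ : [set _ | _] = [set x : 'rV[R]_N | forall i, A i (x 0 i)]);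
    last first.
  by apply/seteqP; split => x + i => /(_ i); rewrite /A/= in_itv/= ler_distl.
rewrite lebesgue_rV_box => [|i]; last exact: measurable_itv.
rewrite (eq_bigr (fun=> (l *+ 2)%:E)) => [|i _].
  by rewrite prodEFin prodr_const card_ord.
rewrite lebesgue_measure_itv/= lte_fin -EFinB.
have -> : (c 0 i + l - (c 0 i - l) = l *+ 2)%R by lra.
(* The interval formula returns 0 when the end points are not strictly increasing; with l >= 0 this
   leaves only l = 0, where 2l is 0 as well. *)
case: ltP => // cl; have -> : l = 0 by lra.
by rewrite mul0rn.
Qed.

End enorm.

(** * Pointwise bound on the modulus by the seminorm *)

Lemma ler_powR_normB {R : realType} (p a b : R) : (0 <= p)%R ->
  (`|a - b| `^ p <= 2 `^ p * (`|a| `^ p + `|b| `^ p))%R.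
Proof.
(* If b is the smaller in absolute value, then |a - b| <= 2|a|. Doing without convexity admits every
   p >= 0 and explains the factor 2^p. *)
move=> p0; wlog ba : a b / (`|b| <= `|a|)%R.
  move=> W; have [/W//|/ltW/W] := leP `|b|%R `|a|%R.
  by rewrite distrC (addrC (`|b| `^ p)%R).
apply: (@le_trans _ _ ((2 * `|a|) `^ p)%R).
  apply: ge0_ler_powR; rewrite ?nnegrE ?mulr_ge0//.
  by rewrite (le_trans (ler_normB _ _))// mulr_natl mulr2n lerD2l.
by rewrite powRM// ler_wpM2l ?powR_ge0// lerDl powR_ge0.
Qed.
(** By translation invariance both terms have the same integral; this is the origin of the factor 2
    in front of 2^p in the final constant. *)
Lemma ge0_integral_rVB_pair {R : realType} {N : nat} (w : 'rV[R]_N -> \bar R)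
    (c : \bar R) (h : 'rV[R]_N) :
  0 <= c -> measurable_fun setT w -> (forall x, 0 <= w x) ->
  \int[lebesgue_rV R N]_z (c * (w z + w (z - h)%R)) =
  c * (\int[lebesgue_rV R N]_z w z + \int[lebesgue_rV R N]_z w z).
Proof.
move=> c0 mw w0.
have mwh : measurable_fun setT (fun z : 'rV[R]_N => w (z - h)%R).
  by apply: (measurableT_comp mw); exact: measurable_funD_rV.
have mw2 := emeasurable_funD mw mwh.
rewrite -[X in _ * (_ + X)](ge0_integral_rVD (- h)%R mw w0).
rewrite -(ge0_integralD _ measurableT (fun x _ => w0 x) mw
  (fun x _ => w0 (x - h)%R) mwh).
by rewrite (ge0_integralZl _ measurableT mw2)// => x _; rewrite adde_ge0.
Qed.

Section modulus_bound.
Context {R : realType} {N : nat}.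
Local Notation V := ('rV[R]_N).
Local Notation lambda := (lebesgue_rV R N).
Variable u : V -> R.
Hypothesis mu : measurable_fun setT u.

Lemma measurable_incr (p : R) (z : V) :
  measurable_fun setT (fun x : V => (`|u (x + z) - u x| `^ p)%:E).
Proof.
exact: measurableT_comp (measurable_increment mu p) (measurable_pair2 z).
Qed.

(** The increment by h is the increment by z minus u(x + z) - u(x + h); shifting x by h shows that
    the latter contributes the modulus at z - h. *)
Lemma modulus_triangle (p : R) (h z : V) : (0 <= p)%R ->
  modulus p u h <= (2 `^ p)%:E * (modulus p u z + modulus p u (z - h)%R).
Proof.
move=> p0.
have pw0 (a : R) : 0 <= (`|a| `^ p)%:E by rewrite lee_fin powR_ge0.
have -> : modulus p u (z - h)%R =
    \int[lambda]_x (`|u (x + z) - u (x + h)| `^ p)%:E.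
  rewrite -[LHS](ge0_integral_rVD h (measurable_incr p (z - h)%R)
    (fun=> pw0 _)).
  by apply: eq_integral => x _ /=; rewrite -addrA (addrC h) subrK.
have mz : measurable_fun setT (fun x : V => (`|u (x + z) - u (x + h)| `^ p)%:E).
  apply/measurable_EFinP/measurable_powR_norm/measurable_funB;
    by apply: (measurableT_comp mu); exact: measurable_funD_rV.
rewrite -ge0_integralD//; last exact: measurable_incr.
rewrite -ge0_integralZl//; last 2 first.
- by apply: emeasurable_funD => //; exact: measurable_incr.
- by move=> x _; rewrite adde_ge0.
apply: ge0_le_integral => //.
- exact: measurable_incr.
- apply: measurable_funeM; apply: emeasurable_funD => //.
  exact: measurable_incr.
move=> x _; rewrite -EFinD -EFinM lee_fin.
rewrite (_ : u (x + h) - u x = (u (x + z) - u x) - (u (x + z) - u (x + h)))%R.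
  exact: ler_powR_normB.
by ring.
Qed.

Lemma measurable_weight (q : R) :
  measurable_fun setT (fun z : V => (enorm z `^ q)^-1%R).
Proof.
under eq_fun do rewrite -powRN.
exact: (measurableT_comp (measurable_powR _) measurable_enorm).
Qed.

Definition weighted_modulus (s p : R) (z : V) : \bar R :=
  ((enorm z `^ (N%:R + s * p))^-1)%:E * modulus p u z.

Lemma weighted_modulus_ge0 s p z : 0 <= weighted_modulus s p z.
Proof. by rewrite mule_ge0 ?modulus_ge0// lee_fin invr_ge0 powR_ge0. Qed.

Lemma measurable_weighted_modulus s p :
  measurable_fun setT (weighted_modulus s p).
Proof.
apply: emeasurable_funM; last exact: measurable_modulus.
apply/measurable_EFinP; exact: measurable_weight.
Qed.

Lemma gagliardo_modulus (s p : R) :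
  gagliardo s p u = \int[lambda]_z weighted_modulus s p z.
Proof.
rewrite -[RHS](double_integral_modulus mu p (measurable_weight _)); last first.
  by move=> z; rewrite invr_ge0 powR_ge0.
apply: eq_integral => xy _; congr EFin.
by rewrite mulrC -(enormN (xy.2 - xy.1)) opprB.
Qed.

(* The modulus at h is dominated by its values at z and z - h; averaging over
   the cube of side |h| centred at h / 2 brings in the seminorm. *)
Lemma modulus_le_gagliardo (s p : R) (h : V) : (0 < s)%R -> (0 < p)%R ->
  modulus p u h <=
    (2 * 2 `^ p * Num.sqrt N%:R `^ (N%:R + s * p) * enorm h `^ (s * p))%:E *
    gagliardo s p u.
Proof.
move=> s0 p0; have [->|h0] := eqVneq h 0%R.
  rewrite modulus0 ?gt_eqF// mule_ge0//.
    by rewrite lee_fin !mulr_ge0// powR_ge0.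
  rewrite gagliardo_modulus integral_ge0// => z _.
  exact: weighted_modulus_ge0.
have l0 := enorm_gt0 h0.
set l := enorm h in l0 *.
have q0 : (0 < N%:R + s * p)%R by rewrite ltr_wpDl// mulr_gt0.
set q := (N%:R + s * p)%R in q0 *.
(* Each |h_i| is at most l, so around h / 2 with half side l / 2 the coordinates of both z and z - h
   stay within l. *)
pose c := ((2^-1)%R *: h)%R.
pose Q := [set x : V | forall i, (`|x 0 i - c 0 i| <= l / 2)%R].
have mQ : measurable Q by exact: measurable_box.
have lQ : lambda Q = (l ^+ N)%:E.
  rewrite lebesgue_rV_cube; last by rewrite divr_ge0// ltW.
  by have -> : (l / 2 *+ 2 = l)%R by lra.
(* B bounds |z|^q on the cube |z_i| <= l, where |z| <= sqrt N * l; multiplying by B thus undoes the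
   weight. *)
set B := ((Num.sqrt N%:R * l) `^ q)%R.
have B0 : (0 <= B)%R by exact: powR_ge0.
have wB (z : V) : (forall i, `|z 0 i| <= l)%R ->
    modulus p u z <= B%:E * weighted_modulus s p z.
  (* At z = 0 the weight is 0, because 0^-1 = 0, so the bound holds there only because the modulus
     vanishes. *)
  move=> zl; have [->|z0] := eqVneq z 0%R.
    by rewrite modulus0 ?gt_eqF// mule_ge0// ?lee_fin// weighted_modulus_ge0.
  have ez0 := enorm_gt0 z0.
  rewrite /weighted_modulus muleA -EFinM -[leLHS]mul1e.
  apply: lee_pmul => //; first exact: modulus_ge0.
  rewrite lee_fin ler_pdivlMr ?powR_gt0// mul1r.
  apply: ge0_ler_powR; rewrite ?nnegrE ?enorm_ge0 ?(ltW q0)//.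
    by rewrite mulr_ge0// ltW.
  by apply: ler_enorm_sqrt => //; exact: ltW.
have hl i : (`|h 0 i| <= l)%R by exact: ler_coord_enorm.
have Qz z : Q z -> forall i, (`|z 0 i| <= l)%R.
  move=> Qz i; have := Qz i; have := hl i.
  rewrite /c mxE !ler_norml => /andP[? ?] /andP[? ?].
  by apply/andP; split; lra.
have Qzh z : Q z -> forall i, (`|(z - h) 0 i| <= l)%R.
  move=> Qz' i; have := Qz' i; have := hl i.
  rewrite /c !mxE !ler_norml => /andP[? ?] /andP[? ?].
  by apply/andP; split; lra.
pose w z := B%:E * weighted_modulus s p z.
have w0 z : 0 <= w z by rewrite mule_ge0 ?weighted_modulus_ge0// lee_fin.
have mw : measurable_fun setT w.
  by apply: measurable_funeM; exact: measurable_weighted_modulus.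
have mwh : measurable_fun setT (fun z : V => w (z - h)%R).
  by apply: (measurableT_comp mw); exact: measurable_funD_rV.
have mw2 : measurable_fun setT (fun z => w z + w (z - h)%R).
  exact: emeasurable_funD mw mwh.
have mW := measurable_funeM (2 `^ p)%:E mw2.
have Iw : \int[lambda]_z w z = B%:E * gagliardo s p u.
  rewrite gagliardo_modulus ge0_integralZl//.
  - exact: measurable_weighted_modulus.
  - by move=> z _; exact: weighted_modulus_ge0.
have key : modulus p u h * (l ^+ N)%:E <=
    (2 * 2 `^ p * B)%:E * gagliardo s p u.
  rewrite -lQ -integral_cst//.
  apply: (@le_trans _ _
      (\int[lambda]_(z in Q) ((2 `^ p)%:E * (w z + w (z - h)%R)))).
    apply: ge0_le_integral => //.
    - by move=> z _; exact: modulus_ge0.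
    - exact: measurable_funTS mW.
    - move=> z Qz'; apply: le_trans (modulus_triangle h z (ltW p0)) _.
      rewrite lee_pmul2l ?lte_fin ?powR_gt0// leeD// wB//.
        exact: Qz.
      exact: Qzh.
  apply: (@le_trans _ _ (\int[lambda]_z ((2 `^ p)%:E * (w z + w (z - h)%R)))).
    apply: ge0_subset_integral => //.
    by move=> z _; rewrite mule_ge0 ?lee_fin ?powR_ge0// adde_ge0.
  rewrite ge0_integral_rVB_pair// Iw.
  rewrite -[X in _ * (X + _)]mul1e -[X in _ * (_ + X)]mul1e.
  rewrite -ge0_muleDl// !muleA.
  by rewrite -EFinD -!EFinM (mulrC 2)%R -mulrA (mulrA _ 2)%R.
(* Since q = N + sp, a factor l^N splits off and cancels the volume of the cube; l^(sp) remains. *)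
have BE : B = (Num.sqrt N%:R `^ q * l `^ (s * p) * l ^+ N)%R.
  rewrite /B powRM ?sqrtr_ge0 ?(ltW l0)// -mulrA; congr (_ * _)%R.
  by rewrite [LHS]powRD ?gt_eqF// powR_mulrn ?(ltW l0)// mulrC.
rewrite -(@lee_pmul2r _ (l ^+ N)%:E)//; last by rewrite lte_fin exprn_gt0.
apply: le_trans key _; rewrite muleAC -EFinM BE.
by rewrite !mulrA.
Qed.

End modulus_bound.
(** * Behaviour of the modulus at infinity *)

(* powR is not continuous at 0, where x `^ p = 1 for x < 0, so the continuity
   of the power is restricted to nonnegative arguments. *)
Lemma powR_near {R : realType} (p b eta : R) : (0 < p -> 0 <= b -> 0 < eta ->
  exists2 delta, 0 < delta & forall a, 0 <= a -> b - delta <= a <= b + delta ->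
    b `^ p - eta <= a `^ p <= b `^ p + eta)%R.
Proof.
move=> p0 b0 eta0.
have bp0 : (0 <= b `^ p)%R by exact: powR_ge0.
have rootK x : (0 <= x)%R -> ((x `^ p^-1) `^ p = x)%R.
  by move=> x0; rewrite -powRrM mulVf ?gt_eqF// powRr1.
have bK : ((b `^ p) `^ p^-1 = b)%R by rewrite -powRrM divff ?gt_eqF// powRr1.
have pV0 : (0 < p^-1)%R by rewrite invr_gt0.
have bhi : (b < (b `^ p + eta) `^ p^-1)%R.
  by rewrite -[ltLHS]bK gt0_ltr_powR ?nnegrE ?ltrDl// addr_ge0// ltW.
pose lo := ((b `^ p - eta) `^ p^-1)%R.
pose d1 := ((b `^ p + eta) `^ p^-1 - b)%R.
have d10 : (0 < d1)%R by rewrite subr_gt0.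
have up d a : (d <= d1 -> 0 <= a -> a <= b + d -> a `^ p <= b `^ p + eta)%R.
  move=> dd a0 ad; rewrite -[leRHS]rootK; last by rewrite addr_ge0// ltW.
  apply: ge0_ler_powR; rewrite ?nnegrE ?powR_ge0 ?(ltW p0)//.
  by rewrite (le_trans ad)// -lerBrDl.
have [etab|beta] := ltP eta (b `^ p)%R; last first.
  exists d1 => // a a0 /andP[_ ab]; rewrite (up d1)// andbT.
  by rewrite (@le_trans _ _ 0%R) ?powR_ge0// subr_le0.
have lo0 : (0 <= b `^ p - eta)%R by rewrite subr_ge0 ltW.
have lob : (lo < b)%R.
  by rewrite -[ltRHS]bK gt0_ltr_powR ?nnegrE// ltrBlDr ltrDl.
exists (Num.min d1 (b - lo))%R; first by rewrite lt_min d10 subr_gt0.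
move=> a a0 /andP[ba ab]; rewrite (up _ _ _ _ ab) ?ge_min ?lexx// andbT.
rewrite -[leLHS]rootK//.
apply: ge0_ler_powR; rewrite ?nnegrE ?powR_ge0 ?(ltW p0)//.
apply: le_trans ba; rewrite -[leLHS]/lo lerBrDl -lerBrDr ge_min.
by apply/orP; right.
Qed.

Section far_field.
Context {R : realType} {N : nat}.
Local Notation V := ('rV[R]_N).
Local Notation lambda := (lebesgue_rV R N).
Local Notation "'N_ p [ f ]" := ('N[lambda]_p%:E[EFin \o f]).
Implicit Types f : V -> R.

Lemma poweR_norm_LnormE f (p : R) : (p != 0)%R ->
  'N_p[f] `^ p = \int[lambda]_x (`|f x| `^ p)%:E.
Proof. by move=> p0; rewrite powR_Lnorm. Qed.

Lemma LnormE f (p : R) : (p != 0)%R ->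
  'N_p[f] = (\int[lambda]_x (`|f x| `^ p)%:E) `^ p^-1.
Proof.
move=> p0; rewrite -poweR_norm_LnormE// -poweRrM divff// poweRe1//.
exact: Lnorm_ge0.
Qed.

Lemma measurable_shift_rV f (z : V) : measurable_fun setT f ->
  measurable_fun setT (fun x : V => f (x + z)%R).
Proof.
by move=> mf; apply: (measurableT_comp mf); exact: measurable_funD_rV.
Qed.

Lemma Lnorm_shift f (p : R) (z : V) : (p != 0)%R -> measurable_fun setT f ->
  'N_p[(fun x : V => f (x + z)%R)] = 'N_p[f].
Proof.
move=> p0 mf; rewrite (LnormE _ p0) [in RHS](LnormE _ p0).
have mfp : measurable_fun setT (fun x => (`|f x| `^ p)%:E).
  by apply/measurable_EFinP; exact: measurable_powR_norm.
have fp0 x : 0 <= (`|f x| `^ p)%:E by rewrite lee_fin powR_ge0.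
by rewrite -[in RHS](ge0_integral_rVD z mfp fp0).
Qed.

(** Minkowski and translation invariance. The bound does not depend on z, so replacing f by a
    truncation costs the same for all z. *)
Lemma Lnorm_increment_le f (p : R) (z : V) : (1 <= p)%R ->
  measurable_fun setT f ->
  'N_p[(fun x : V => f (x + z) - f x)%R] <= 2%:E * 'N_p[f].
Proof.
move=> p1 mf; have p0 : (p != 0)%R by rewrite gt_eqF// (lt_le_trans _ p1).
have mfz := measurable_shift_rV z mf.
have mNf : measurable_fun setT (\- f)%R by exact: measurable_funN.
apply: le_trans (minkowski_EFin lambda mfz mNf p1) _.
rewrite (Lnorm_shift z p0 mf) (_ : EFin \o (\- f)%R = \- (EFin \o f))//.
by rewrite oppe_Lnorm mule_natl mule2n.
Qed.

Lemma modulus_LnormE f (p : R) (z : V) : (p != 0)%R ->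
  modulus p f z = 'N_p[(fun x : V => f (x + z) - f x)%R] `^ p.
Proof. by move=> p0; rewrite poweR_norm_LnormE. Qed.

Definition box (M : R) : set V := [set x | forall i, `|x 0 i| <= M]%R.

Lemma measurable_box0 (M : R) : measurable (box M).
Proof.
have := measurable_box (0 : V) M; congr measurable.
by apply/seteqP; split => x bx i; have := bx i; rewrite mxE subr0.
Qed.

(** A cut-off in space, not in height: a bounded support is what makes far translates disjoint. *)
Definition trunc f (M : R) (x : V) : R := f x * \1_(box M) x.

Lemma measurable_trunc f M : measurable_fun setT f ->
  measurable_fun setT (trunc f M).
Proof.
move=> mf; apply: measurable_funM => //.
by apply: measurable_indic; exact: measurable_box0.
Qed.


Lemma trunc_box f M x : box M x -> trunc f M x = f x.
Proof. by move=> bx; rewrite /trunc indicE mem_set// mulr1. Qed.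

Lemma trunc_nbox f M x : ~ box M x -> trunc f M x = 0%R.
Proof. by move=> bx; rewrite /trunc indicE memNset// mulr0. Qed.

(** A vector longer than sqrt N * 2M has a coordinate larger than 2M, so x and x + z are never both
    in the cube. At each x one of the two values vanishes, and the p-th power becomes additive. *)
Lemma modulus_trunc f (p M : R) (z : V) : (0 < p)%R -> (0 <= M)%R ->
  measurable_fun setT f -> (Num.sqrt N%:R * (2 * M) < enorm z)%R ->
  modulus p (trunc f M) z = 2%:E * \int[lambda]_x (`|trunc f M x| `^ p)%:E.
Proof.
move=> p0 M0 mf zM; set v := trunc f M.
have mv : measurable_fun setT v by exact: measurable_trunc.
have mvp : measurable_fun setT (fun x => (`|v x| `^ p)%:E).
  by apply/measurable_EFinP; exact: measurable_powR_norm.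
have vp0 x : 0 <= (`|v x| `^ p)%:E by rewrite lee_fin powR_ge0.
have mvz : measurable_fun setT (fun x : V => (`|v (x + z)%R| `^ p)%:E).
  by apply/measurable_EFinP/measurable_powR_norm; exact: measurable_shift_rV.
have disj x : box M x -> ~ box M (x + z)%R.
  move=> bx bxz; move: zM; rewrite ltNge => /negP; apply.
  apply: ler_enorm_sqrt; first by rewrite mulr_ge0.
  move=> i.
  have -> : (z 0 i = (x + z) 0 i - x 0 i)%R by rewrite mxE addrC addKr.
  by rewrite (le_trans (ler_normB _ _))// mulr_natl mulr2n lerD.
have vE x : (`|v (x + z) - v x| `^ p)%:E =
    (`|v (x + z)%R| `^ p)%:E + (`|v x| `^ p)%:E.
  have p_neq0 : (p != 0)%R by rewrite gt_eqF.
  have [bx|bx] := pselect (box M x).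
    rewrite {1 3}/v (trunc_nbox _ (disj _ bx)).
    by rewrite sub0r normrN normr0 powR0// add0e.
  by rewrite [v x]trunc_nbox// subr0 normr0 powR0// adde0.
rewrite /modulus (eq_integral _ _ (fun x _ => vE x)).
rewrite (ge0_integralD _ measurableT (fun (x : V) _ => vp0 (x + z)%R) mvz
  (fun x _ => vp0 x) mvp).
have -> := ge0_integral_rVD z mvp vp0.
by rewrite mule_natl mule2n.
Qed.

Lemma trunc_tail f (p delta : R) : (0 < p)%R -> (0 < delta)%R ->
  measurable_fun setT f -> \int[lambda]_x (`|f x| `^ p)%:E < +oo ->
  exists2 M, (0 <= M)%R & 'N_p[(fun x => f x - trunc f M x)%R] <= delta%:E.
Proof.
move=> p0 d0 mf foo; have p_neq0 : (p != 0)%R by rewrite gt_eqF.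
pose F n x := (`|f x - trunc f n%:R x| `^ p)%:E.
have mfp : measurable_fun setT (fun x => (`|f x| `^ p)%:E).
  by apply/measurable_EFinP; exact: measurable_powR_norm.
have : \int[lambda]_x F n x @[n --> \oo] --> \int[lambda]_x (cst 0 x).
  apply: (@dominated_cvg _ _ _ _ _ _ F _ (fun x => (`|f x| `^ p)%:E)) => //.
  - move=> n; apply/measurable_EFinP/measurable_powR_norm/measurable_funB => //.
    exact: measurable_trunc.
  (* As soon as n >= |x|, the point lies in the cube and the difference is exactly 0. *)
  - move=> x _; apply: cvg_near_cst; near=> n.
    rewrite /F trunc_box ?subrr ?normr0 ?powR0// => i.
    apply: (le_trans (ler_coord_enorm x i)); near: n; exact: nbhs_infty_ger.
  - apply/integrableP; split => //.
    by under eq_integral do rewrite gee0_abs ?lee_fin ?powR_ge0//.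
  - move=> n x _; rewrite /F gee0_abs ?lee_fin ?powR_ge0//.
    have [bx|bx] := pselect (box n%:R x).
      by rewrite trunc_box// subrr normr0 powR0// powR_ge0.
    by rewrite trunc_nbox// subr0.
rewrite integral0 => /fine_cvgP[Ffin /cvgr_le/(_ (delta `^ p)%R)].
rewrite powR_gt0// => /(_ isT) Fd.
have [n [Fn1 Fn2]] : exists n, \int[lambda]_x F n x \is a fin_num /\
    (fine (\int[lambda]_x F n x) <= delta `^ p)%R.
  by near \oo => n; exists n; split; near: n.
exists n%:R => //; rewrite (LnormE _ p_neq0).
rewrite -[X in X `^ _]/(\int[lambda]_x F n x).
rewrite -(fineK Fn1) poweR_EFin lee_fin.
have -> : delta = ((delta `^ p) `^ p^-1)%R.
  by rewrite -powRrM divff// powRr1// ltW.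
apply: ge0_ler_powR; rewrite ?nnegrE ?powR_ge0 ?invr_ge0 ?(ltW p0)//.
by apply: fine_ge0; apply: integral_ge0 => x _; rewrite lee_fin powR_ge0.
Unshelve. all: by end_near.
Qed.

End far_field.
(** Write f = v + w with v a truncation and w small in norm. The increment of v has norm exactly
    2^(1/p) ||v||, and Minkowski in both directions transfers this to f up to an error uniform in
    z. *)
Lemma modulus_far {R : realType} {N : nat} (f : 'rV[R]_N -> R) (p eta : R) :
  (1 <= p)%R -> (0 < eta)%R -> measurable_fun setT f ->
  \int[lebesgue_rV R N]_x (`|f x| `^ p)%:E < +oo ->
  exists r0 : R, forall z, (r0 < enorm z)%R ->
    (2 * fine (\int[lebesgue_rV R N]_x (`|f x| `^ p)%:E) - eta)%:E
      <= modulus p f z <=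
    (2 * fine (\int[lebesgue_rV R N]_x (`|f x| `^ p)%:E) + eta)%:E.
Proof.
move=> p1 eta0 mf foo; have p0 : (0 < p)%R by exact: lt_le_trans p1.
have pN0 : (p != 0)%R by rewrite gt_eqF.
set If := \int[_]_x (`|f x| `^ p)%:E in foo *.
have If0 : 0 <= If by apply: integral_ge0 => x _; rewrite lee_fin powR_ge0.
have Iffin : If \is a fin_num by rewrite ge0_fin_numE.
set A := (2 * fine If)%R; have A0 : (0 <= A)%R by rewrite mulr_ge0// fine_ge0.
have AE : A%:E = 2%:E * If by rewrite EFinM fineK.
(* The limit expected for the norm of the increment, namely 2^(1/p) ||f||. *)
pose b := (A `^ p^-1)%R; have b0 : (0 <= b)%R by exact: powR_ge0.
have bA : (b `^ p = A)%R by rewrite -powRrM mulVf// powRr1.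
have [delta d0 near_b] := powR_near p0 b0 eta0.
(* A remainder w of norm at most delta / 4 enters twice, through its increment and, in the lower
   bound, through 2^(1/p) ||w||. Each is at most delta / 2, the second because p >= 1. *)
have d40 : (0 < delta / 4)%R by rewrite divr_gt0.
have [M M0 wM] := trunc_tail p0 d40 mf foo.
exists (Num.sqrt N%:R * (2 * M))%R => z zM.
set L := fun g => 'N[lebesgue_rV R N]_p%:E[EFin \o g].
set v := trunc f M; set w : _ -> R := (fun x => f x - v x)%R.
pose T (g : 'rV[R]_N -> R) (x : 'rV[R]_N) : R := (g (x + z) - g x)%R.
have mv : measurable_fun setT v by exact: measurable_trunc.
have mw : measurable_fun setT w by exact: measurable_funB.
have mT g : measurable_fun setT g -> measurable_fun setT (T g).
  by move=> mg; apply: measurable_funB => //; exact: measurable_shift_rV.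
have Tw : L (T w) <= (delta / 2)%:E.
  apply: le_trans (Lnorm_increment_le z p1 mw) _.
  apply: (@le_trans _ _ (2%:E * (delta / 4)%:E)); first by rewrite lee_pmul2l.
  by rewrite -EFinM lee_fin; lra.
have TfE : L (T f) <= L (T v) + L (T w).
  have -> : T f = (T v \+ T w)%R by apply/funext => x; rewrite /T /w/=; lra.
  exact: minkowski_EFin (mT _ mv) (mT _ mw) p1.
have TvE : L (T v) <= L (T f) + L (T w).
  have -> : T v = (T f \+ (\- T w))%R.
    by apply/funext => x; rewrite /T /w/=; lra.
  apply: le_trans (minkowski_EFin _ (mT _ mf) (measurable_funN (mT _ mw)) p1) _.
  by rewrite (_ : EFin \o (\- T w)%R = \- (EFin \o T w))// oppe_Lnorm.
have fE : L f <= L v + L w.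
  have -> : f = (v \+ w)%R by apply/funext => x; rewrite /w/=; lra.
  exact: minkowski_EFin mv mw p1.
have p21 : ((2 `^ p^-1) <= 2 :> R)%R.
  by apply: ler1_powR; rewrite ?ler1n// invf_le1.
have LTv : L (T v) = (2 `^ p^-1)%:E * L v.
  have Iv0 : 0 <= \int[lebesgue_rV R N]_x (`|v x| `^ p)%:E.
    by apply: integral_ge0 => x _; rewrite lee_fin powR_ge0.
  rewrite [LHS](LnormE (T v) pN0) [L v](LnormE v pN0).
  by rewrite [X in X `^ _](modulus_trunc p0 M0 mf zM) poweRM.
have bE : b%:E = (2 `^ p^-1)%:E * L f.
  by rewrite /b -poweR_EFin AE poweRM// /L LnormE.
have L0 g : 0 <= L g by exact: Lnorm_ge0.
have vp0 x : 0 <= (`|v x| `^ p)%:E by rewrite lee_fin powR_ge0.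
have Lvf : L v <= L f.
  rewrite /L (LnormE v pN0) (LnormE f pN0).
  apply: gt0_ler_poweR; rewrite ?invr_ge0 ?(ltW p0)//.
  - by rewrite in_itv/= leey andbT; apply: integral_ge0 => x _; exact: vp0.
  - by rewrite in_itv/= leey andbT.
  apply: ge0_le_integral => //.
  - by apply/measurable_EFinP; exact: measurable_powR_norm.
  - by apply/measurable_EFinP; exact: measurable_powR_norm.
  move=> x _; rewrite lee_fin; have [bx|bx] := pselect (box M x).
    by rewrite /v trunc_box.
  by rewrite /v trunc_nbox// normr0 powR0// powR_ge0.
have c0 : 0 < (2 `^ p^-1)%:E :> \bar R by rewrite lte_fin powR_gt0.
have up : L (T f) <= (b + delta)%:E.
  apply: le_trans TfE _; rewrite EFinD; apply: leeD.
    by rewrite LTv bE lee_pmul2l.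
  by apply: le_trans Tw _; rewrite lee_fin; lra.
have low : b%:E <= L (T f) + delta%:E.
  have -> : delta%:E = (delta / 2)%:E + (delta / 2)%:E.
    by rewrite -EFinD -splitr.
  rewrite addeA; apply: (@le_trans _ _ (L (T v) + (delta / 2)%:E)).
    rewrite bE; apply: (@le_trans _ _ ((2 `^ p^-1)%:E * (L v + L w))).
      by rewrite lee_pmul2l.
    rewrite ge0_muleDr// -LTv leeD2l//.
    apply: (@le_trans _ _ (2%:E * (delta / 4)%:E)).
      by apply: lee_pmul => //; rewrite ?lee_fin ?powR_ge0.
    by rewrite -EFinM lee_fin; lra.
  by rewrite leeD2r// (le_trans TvE)// leeD2l.
have Tffin : L (T f) \is a fin_num.
  by rewrite ge0_fin_numE// (le_lt_trans up)// ltry.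
have -> : modulus p f z = ((fine (L (T f))) `^ p)%:E.
  by rewrite (modulus_LnormE f z pN0) -poweR_EFin fineK.
rewrite !lee_fin -bA; apply: near_b; first exact: fine_ge0.
move: up low; rewrite -(fineK Tffin) -EFinD !lee_fin => up low.
by rewrite up andbT lerBlDr.
Qed.
(** * Passing to Borel representatives *)

Lemma ge0_integral_ae_in d (T : measurableType d) (R : realType)
    (mu : {measure set T -> \bar R}) (A : set T) (f g : T -> \bar R) :
  measurable A -> (forall x, 0 <= f x) -> (forall x, 0 <= g x) ->
  measurable_fun [set: T] g -> {ae mu, forall x, f x = g x} ->
  \int[mu]_(x in A) f x = \int[mu]_(x in A) g x.
Proof.
move=> mA f0 g0 mg fg; rewrite integral_mkcond [RHS]integral_mkcond.
apply: ge0_integral_ae.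
- by move=> x; exact: erestrict_ge0.
- by move=> x; exact: erestrict_ge0.
- by apply/(measurable_restrictT _ mA); exact: measurable_funTS.
- by apply: filterS fg => x fgx; rewrite !patchE fgx.
Qed.

Section representative.
Context {R : realType} {N : nat}.
Local Notation V := ('rV[R]_N).
Local Notation lambda := (lebesgue_rV R N).

(** The representative is f replaced by 0 on a null Borel set, so nonnegativity survives, as the
    kernels require. *)
Lemma lebesgue_measurable_borel (f : V -> R) : lebesgue_measurable_fun f ->
  exists g, [/\ measurable_fun setT g, {ae lambda, forall x, f x = g x} &
    (forall x, 0 <= f x)%R -> forall x, (0 <= g x)%R].
Proof.
move=> /completed_measurable_ae_borel[Z [mZ Z0 mg]].
exists (fun x => if x \in Z then 0%R else f x); split => //.
  by exists Z; split => // x /=; apply: contra_notP => Zx; rewrite memNset.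
by move=> f0 x; case: ifP.
Qed.

Lemma lebesgue_rV_preimageD (a : V) (A : set V) : measurable A ->
  lambda ((fun x => x + a)%R @^-1` A) = lambda A.
Proof.
move=> mA.
have mA1 : measurable_fun setT (fun x : V => (\1_A x : R)%:E).
  by apply/measurable_EFinP; exact: measurable_indic.
have A10 (x : V) : 0 <= (\1_A x : R)%:E by rewrite lee_fin.
have mAa : measurable ((fun x => x + a)%R @^-1` A).
  by rewrite -[X in measurable X]setTI; exact: measurable_funD_rV.
transitivity (\int[lambda]_x (\1_A x : R)%:E); last first.
  by rewrite integral_indic// setIT.
rewrite -[RHS](ge0_integral_rVD a mA1 A10).
by have := integral_indic lambda measurableT mAa; rewrite setIT => <-.
Qed.

Lemma ae_shift (a : V) (P : V -> Prop) : {ae lambda, forall x, P x} ->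
  {ae lambda, forall x, P (x + a)%R}.
Proof.
move=> [Z [mZ Z0 PZ]]; exists ((fun x => x + a)%R @^-1` Z); split.
- by rewrite -[X in measurable X]setTI; exact: measurable_funD_rV.
- by rewrite lebesgue_rV_preimageD.
- by move=> x /= Px; apply: PZ.
Qed.

Lemma ae_prod (P : V * V -> Prop) (Z : set (V * V)) : measurable Z ->
  (forall xy, ~ Z xy -> P xy) -> (forall x, lambda (xsection Z x) = 0) ->
  {ae (lambda \x lambda), forall xy, P xy}.
Proof.
move=> mZ PZ Z0; exists Z; split => //.
- rewrite /product_measure1/= (eq_integral (cst 0)) ?integral0// => x _.
  exact: Z0.
- by move=> xy; apply: contra_notP => Zxy; exact: PZ.
Qed.

Lemma ae_prod_fst (P : V -> Prop) : {ae lambda, forall x, P x} ->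
  {ae (lambda \x lambda), forall xy, P xy.1}.
Proof.
move=> [Z [mZ Z0 PZ]]; exists (Z `*` setT); split.
- exact: measurableX.
- by rewrite product_measure1E// [X in X * _]Z0 mul0e.
- by move=> xy /= Pxy; split => //; apply: PZ.
Qed.

Lemma ae_prod_snd (P : V -> Prop) : {ae lambda, forall x, P x} ->
  {ae (lambda \x lambda), forall xy, P xy.2}.
Proof.
move=> [Z [mZ Z0 PZ]]; exists (setT `*` Z); split.
- exact: measurableX.
- by rewrite product_measure1E// [X in _ * X]Z0 mule0.
- by move=> xy /= Pxy; split => //; apply: PZ.
Qed.

(** For fixed x, the y with y - x in Z form a translate of Z, so every section is null. This allows
    a kernel evaluated at y - x to be changed on a null set. *)
Lemma ae_prod_sub (P : V -> Prop) : {ae lambda, forall x, P x} ->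
  {ae (lambda \x lambda), forall xy, P (xy.2 - xy.1)%R}.
Proof.
move=> [Z [mZ Z0 PZ]].
apply: (@ae_prod _ ((fun xy => xy.2 - xy.1)%R @^-1` Z)).
- rewrite -[X in measurable X]setTI.
  by apply: measurable_funD_rV => //; exact: measurable_funN_rV.
- by move=> xy; apply: contra_notP; exact: PZ.
- move=> x; rewrite -Z0 -(lebesgue_rV_preimageD (- x)%R mZ); congr (lambda _).
  by apply/seteqP; split => y /=; rewrite /xsection/= inE.
Qed.

End representative.

(** * Energies as integrals of the kernel against the modulus *)

Section energy.
Context {R : realType} {N : nat}.
Local Notation V := ('rV[R]_N).
Local Notation lambda := (lebesgue_rV R N).

Section ae_equal.
Variables (u u' : V -> R).
Hypotheses (mu' : measurable_fun setT u')
  (uu' : {ae lambda, forall x, u x = u' x}).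

Let ae_uu : {ae (lambda \x lambda),
  forall xy, u xy.1 - u xy.2 = u' xy.1 - u' xy.2}%R.
Proof. by apply: filterS2 (ae_prod_fst uu') (ae_prod_snd uu') => x -> ->. Qed.

Let mdiff : measurable_fun setT (fun xy : V * V => u' xy.1 - u' xy.2)%R.
Proof. by apply: measurable_funB; exact: measurableT_comp. Qed.

Lemma measurable_kernel_sub (k : V -> R) : measurable_fun setT k ->
  measurable_fun setT (fun xy : V * V => k (xy.2 - xy.1)%R).
Proof.
move=> mk; apply: (measurableT_comp mk).
by apply: measurable_funD_rV => //; exact: measurable_funN_rV.
Qed.

Lemma gagliardo_ae (s p : R) : gagliardo s p u = gagliardo s p u'.
Proof.
apply: ge0_integral_ae.
- by move=> x; rewrite lee_fin divr_ge0 ?powR_ge0.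
- by move=> x; rewrite lee_fin divr_ge0 ?powR_ge0.
- apply/measurable_EFinP/measurable_funM; first exact: measurable_powR_norm.
  rewrite (_ : (fun xy : V * V => _) =
      (fun xy => (enorm (xy.2 - xy.1) `^ (N%:R + s * p))^-1)%R).
    exact: (measurable_kernel_sub (measurable_weight (N%:R + s * p)%R)).
  by apply/funext => xy; rewrite -enormN opprB.
- by apply: filterS ae_uu => x ->.
Qed.

Lemma nonlocal_energy_modulus (p : R) (k k' : V -> R) :
  (forall z, 0 <= k z)%R -> (forall z, 0 <= k' z)%R -> measurable_fun setT k' ->
  {ae lambda, forall z, k z = k' z} ->
  nonlocal_energy p k u = \int[lambda]_z ((k' z)%:E * modulus p u' z).
Proof.
move=> k0 k'0 mk' kk'; rewrite -(double_integral_modulus mu' p mk' k'0).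
apply: ge0_integral_ae.
- by move=> x; rewrite lee_fin mulr_ge0 ?powR_ge0.
- by move=> x; rewrite lee_fin mulr_ge0 ?powR_ge0.
- apply/measurable_EFinP/measurable_funM; last exact: measurable_powR_norm.
  exact: measurable_kernel_sub.
- by apply: filterS2 ae_uu (ae_prod_sub kk') => x -> ->.
Qed.

Lemma measurable_kernel_modulus (p : R) (k' : V -> R) :
  measurable_fun setT k' ->
  measurable_fun setT (fun z => (k' z)%:E * modulus p u' z).
Proof.
move=> mk'; apply: emeasurable_funM; first exact/measurable_EFinP.
exact: measurable_modulus.
Qed.

(** No exchange of integrals is involved: the exceptional z come from the kernel alone, and for each
    other z the inner integrands agree for almost every x. *)
Lemma local_energy_modulus (p : R) (k k' : V -> R) (A : set V) :
  (forall z, 0 <= k z)%R -> (forall z, 0 <= k' z)%R -> measurable_fun setT k' ->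
  {ae lambda, forall z, k z = k' z} -> measurable A ->
  \int[lambda]_(z in A) \int[lambda]_x (k z * `|u (x + z)%R - u x| `^ p)%:E =
  \int[lambda]_(z in A) ((k' z)%:E * modulus p u' z).
Proof.
move=> k0 k'0 mk' kk' mA; apply: ge0_integral_ae_in => //.
- by move=> z; apply: integral_ge0 => x _; rewrite lee_fin mulr_ge0 ?powR_ge0.
- by move=> z; rewrite mule_ge0 ?lee_fin ?modulus_ge0.
- exact: measurable_kernel_modulus.
apply: filterS kk' => z kz; rewrite -kz.
have pw0 x : setT x -> 0 <= (`|u' (x + z)%R - u' x| `^ p)%:E.
  by rewrite lee_fin powR_ge0.
have kz0 : 0 <= (k z)%:E by rewrite lee_fin.
rewrite -[RHS](ge0_integralZl _ measurableT (measurable_incr mu' p z) pw0 kz0).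
apply: ge0_integral_ae.
- by move=> x; rewrite lee_fin mulr_ge0 ?powR_ge0.
- by move=> x; rewrite mule_ge0 ?lee_fin ?powR_ge0.
- by apply: measurable_funeM; exact: measurable_incr.
- by apply: filterS2 uu' (ae_shift z uu') => x -> ->.
Qed.

End ae_equal.

Lemma measurable_enorm_gt (r : R) : measurable [set z : V | (enorm z > r)%R].
Proof.
rewrite (_ : [set _ | _] = setT `&` @enorm R N @^-1` `]r, +oo[%classic).
  by apply: measurable_enorm => //; exact: measurable_itv.
by rewrite setTI; apply/seteqP; split => z /=; rewrite in_itv/= andbT.
Qed.

Lemma measurable_enorm_lt (r : R) : measurable [set z : V | (enorm z < r)%R].
Proof.
rewrite (_ : [set _ | _] = setT `&` @enorm R N @^-1` `]-oo, r[%classic).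
  by apply: measurable_enorm => //; exact: measurable_itv.
by rewrite setTI; apply/seteqP; split => z /=; rewrite in_itv.
Qed.

(** This and the next two definitions unfold to the integrals in the two hypotheses and in the
    second claim of the theorem. *)
Definition far_mass (k : V -> R) (r : R) :=
  \int[lambda]_(z in [set z | (enorm z > r)%R]) (k z)%:E.

Definition near_moment (s p : R) (k : V -> R) (r : R) :=
  \int[lambda]_(z in [set z | (enorm z < r)%R])
    (enorm z `^ (s * p) * k z)%:E.

Definition near_energy (p : R) (k : V -> R) (u : V -> R) (r : R) :=
  \int[lambda]_(z in [set z | (enorm z < r)%R])
    \int[lambda]_x (k z * `|u (x + z)%R - u x| `^ p)%:E.

End energy.
(** * Bounds on the energy *)

Section energy_bounds.
Context {R : realType} {N : nat}.
Local Notation V := ('rV[R]_N).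
Local Notation lambda := (lebesgue_rV R N).
Variables (s p : R) (u : V -> R).
Hypotheses (p1 : (1 <= p)%R) (s0 : (0 < s)%R) (Wu : Wsp s p u).

Let p0 : (0 < p)%R. Proof. exact: lt_le_trans p1. Qed.

Lemma Wsp_borel : exists u' : V -> R, [/\ measurable_fun setT u',
  {ae lambda, forall x, u x = u' x},
  \int[lambda]_x (`|u' x| `^ p)%:E = 'N[lambda]_p%:E[EFin \o u] `^ p,
  'N[lambda]_p%:E[EFin \o u] `^ p \is a fin_num &
  exists2 K, (0 <= K)%R &
    forall z, modulus p u' z <= (K * enorm z `^ (s * p))%:E].
Proof.
have [lu uoo goo] := Wu.
have [u' [mu' uu' _]] := lebesgue_measurable_borel lu.
exists u'; split => //.
- rewrite [RHS](poweR_norm_LnormE u (lt0r_neq0 p0)); apply/esym/ge0_integral_ae.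
  + by move=> x; rewrite lee_fin powR_ge0.
  + by move=> x; rewrite lee_fin powR_ge0.
  + by apply/measurable_EFinP; exact: measurable_powR_norm.
  + by apply: filterS uu' => x ->.
- by rewrite fin_num_poweR// ge0_fin_numE// Lnorm_ge0.
have g0 : 0 <= gagliardo s p u.
  by apply: integral_ge0 => x _; rewrite lee_fin divr_ge0 ?powR_ge0.
have gfin : gagliardo s p u \is a fin_num by rewrite ge0_fin_numE.
exists (2 * 2 `^ p * Num.sqrt N%:R `^ (N%:R + s * p) *
  fine (gagliardo s p u))%R.
  by rewrite !mulr_ge0 ?powR_ge0// fine_ge0.
move=> z; apply: le_trans (modulus_le_gagliardo mu' z s0 p0) _.
rewrite -(gagliardo_ae mu' uu') -(fineK gfin) -EFinM lee_fin/=.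
by rewrite mulrAC.
Qed.

(** K and r0 are chosen before the kernel, so the estimates hold for all rho_e simultaneously;
    nothing about u is needed afterwards except that its norm is finite. *)
Lemma energy_bounds : exists2 K : R, (0 <= K)%R &
  (forall (k : V -> R) (r r' : R), lebesgue_measurable_fun k ->
    (forall z, 0 <= k z)%R -> (r <= r')%R ->
    near_energy p k u r <= K%:E * near_moment s p k r') /\
  (forall eta : R, (0 < eta)%R -> exists r0 : R, forall (k : V -> R) (r : R),
    lebesgue_measurable_fun k -> (forall z, 0 <= k z)%R -> (r0 < r)%R ->
    let A := (2 * fine ('N[lambda]_p%:E[EFin \o u] `^ p))%R in
    (A - eta)%:E * far_mass k r <= nonlocal_energy p k u /\
    nonlocal_energy p k u <=
      (A + eta)%:E * far_mass k r + K%:E * near_moment s p k (r + 1)%R).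
Proof.
have [u' [mu' uu' Iu' Ifin [K K0 Kmod]]] := Wsp_borel.
have sp_ge0 (z : V) : (0 <= enorm z `^ (s * p))%R by exact: powR_ge0.
have mweight : measurable_fun setT (fun z : V => enorm z `^ (s * p))%R.
  exact: (measurableT_comp (measurable_powR _) measurable_enorm).
exists K => //.
(* Two radii, because the moments are controlled for large radii only, while the second claim
   concerns every r > 0. *)
have near_le (k k' : V -> R) (r r' : R) : (forall z, 0 <= k z)%R ->
    (forall z, 0 <= k' z)%R -> measurable_fun setT k' ->
    {ae lambda, forall z, k z = k' z} -> (r <= r')%R ->
    \int[lambda]_(z in [set z | (enorm z < r)%R])
      ((k' z)%:E * modulus p u' z) <=
    K%:E * near_moment s p k r'.
  move=> k0 k'0 mk' kk' rr'.
  have mg : measurable_fun setT (fun z => (enorm z `^ (s * p) * k' z)%:E).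
    by apply/measurable_EFinP/measurable_funM.
  have g0 z : 0 <= (enorm z `^ (s * p) * k' z)%:E by rewrite lee_fin mulr_ge0.
  have mr := @measurable_enorm_lt R N r.
  have mr' := @measurable_enorm_lt R N r'.
  have -> : near_moment s p k r' =
      \int[lambda]_(z in [set z | (enorm z < r')%R])
        (enorm z `^ (s * p) * k' z)%:E.
    apply: ge0_integral_ae_in => //.
      by move=> z; rewrite lee_fin mulr_ge0.
    by apply: filterS kk' => z ->.
  have gD D : forall z, D z -> 0 <= (enorm z `^ (s * p) * k' z)%:E by [].
  have K0' : 0 <= K%:E by rewrite lee_fin.
  rewrite -(ge0_integralZl _ mr' (measurable_funTS mg) (gD _) K0').
  have mKg := measurable_funeM K%:E mg.
  have Kg0 z : 0 <= K%:E * (enorm z `^ (s * p) * k' z)%:E by rewrite mule_ge0.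
  apply: (@le_trans _ _ (\int[lambda]_(z in [set z | (enorm z < r)%R])
      (K%:E * (enorm z `^ (s * p) * k' z)%:E))).
    apply: ge0_le_integral => //.
    - by move=> z _; rewrite mule_ge0 ?lee_fin ?modulus_ge0.
    - by apply: measurable_funTS; exact: measurable_kernel_modulus.
    - exact: measurable_funTS mKg.
    move=> z _.
    apply: (@le_trans _ _ ((k' z)%:E * (K * enorm z `^ (s * p))%:E)).
      by apply: lee_wpmul2l; rewrite ?lee_fin.
    by rewrite -!EFinM lee_fin mulrC mulrA.
  apply: ge0_subset_integral => //; first exact: measurable_funTS mKg.
  by move=> z /= zr; exact: lt_le_trans rr'.
split.
  move=> k r r' lk k0 rr'.
  have [k' [mk' kk' /(_ k0) k'0]] := lebesgue_measurable_borel lk.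
  rewrite /near_energy.
  rewrite (local_energy_modulus mu' uu' p k0 k'0 mk' kk'
    (measurable_enorm_lt r)).
  exact: near_le.
move=> eta eta0.
have Ioo : \int[lambda]_x (`|u' x| `^ p)%:E < +oo by rewrite Iu' ltey_eq Ifin.
have [r0 r0P] := modulus_far p1 eta0 mu' Ioo; rewrite Iu' in r0P.
exists r0 => k r lk k0 r0r A.
have [k' [mk' kk' /(_ k0) k'0]] := lebesgue_measurable_borel lk.
have A0 : (0 <= A)%R by rewrite mulr_ge0// fine_ge0// poweR_ge0.
rewrite (nonlocal_energy_modulus mu' uu' p k0 k'0 mk' kk').
pose E := [set z : V | (enorm z > r)%R].
have mE : measurable E by exact: measurable_enorm_gt.
have k'E0 z : E z -> 0 <= (k' z)%:E by rewrite lee_fin.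
have mk'E : measurable_fun E (EFin \o k').
  by apply: measurable_funTS; exact/measurable_EFinP.
have -> : far_mass k r = \int[lambda]_(z in E) (k' z)%:E.
  apply: ge0_integral_ae_in => //; [exact/measurable_EFinP|].
  by apply: filterS kk' => z ->.
have mg := measurable_kernel_modulus mu' p mk'.
have g0 z : 0 <= (k' z)%:E * modulus p u' z.
  by rewrite mule_ge0 ?lee_fin ?modulus_ge0.
have gE0 D : forall z, D z -> 0 <= (k' z)%:E * modulus p u' z by [].
split.
  (* A coefficient that is not positive cannot be moved under the integral by the nonnegative
     linearity rule, but then the left side is at most 0. *)
  have [Aeta|Aeta] := leP (A - eta)%R 0%R.
    apply: (@le_trans _ _ 0); last exact: integral_ge0.
    by apply: mule_le0_ge0; rewrite ?lee_fin//; exact: integral_ge0.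
  rewrite -(ge0_integralZl _ mE mk'E k'E0); last by rewrite lee_fin ltW.
  apply: (@le_trans _ _ (\int[lambda]_(z in E) ((k' z)%:E * modulus p u' z)));
      last first.
    exact: ge0_subset_integral.
  apply: ge0_le_integral => //.
  - by move=> z Ez; rewrite mule_ge0// ?lee_fin ?(ltW Aeta)//.
  - exact: measurable_funeM.
  - exact: measurable_funTS mg.
  move=> z Ez; rewrite muleC; apply: lee_wpmul2l; first exact: k'E0.
  by have /andP[] := r0P z (lt_trans r0r Ez).
have AeB : 0 <= (A + eta)%:E by rewrite lee_fin addr_ge0// ltW.
have mCE : measurable (~` E) by exact: measurableC.
have -> : \int[lambda]_z ((k' z)%:E * modulus p u' z) =
    \int[lambda]_(z in E) ((k' z)%:E * modulus p u' z) +
    \int[lambda]_(z in ~` E) ((k' z)%:E * modulus p u' z).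
  rewrite -(ge0_integral_setU lambda mE mCE) ?setUv//.
  by apply/disj_set2P; rewrite setICr.
apply: leeD.
  rewrite -(ge0_integralZl _ mE mk'E k'E0 AeB).
  apply: ge0_le_integral => //.
  - exact: measurable_funTS mg.
  - exact: measurable_funeM.
  move=> z Ez; rewrite [leRHS]muleC; apply: lee_wpmul2l; first exact: k'E0.
  by have /andP[] := r0P z (lt_trans r0r Ez).
(* The complement of E is the closed ball of radius r, while [near_moment] integrates over an open
   one; radius r + 1 covers it. *)
apply: le_trans (near_le k k' (r + 1) (r + 1) k0 k'0 mk' kk' (lexx _))%R.
apply: ge0_subset_integral => //.
- exact: measurable_enorm_lt.
- exact: measurable_funTS mg.
- by move=> z /= /negP; rewrite -leNgt => /le_lt_trans; apply; rewrite ltrDl.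
Qed.
End energy_bounds.

(** * Limits in the extended reals as two-sided bounds *)

Section limits.
Context {R : realType}.

Lemma fin_num_between (x : \bar R) (a b : R) : a%:E <= x -> x <= b%:E ->
  x \is a fin_num.
Proof.
move=> ax xb.
rewrite fin_numE -ltNye -ltey (lt_le_trans (ltNyr _) ax).
by rewrite (le_lt_trans xb (ltry _)).
Qed.

Lemma cvg_EFin_near (T : Type) (F : set_system T) {FF : Filter F}
    (f : T -> \bar R) (l : R) : f @ F --> l%:E ->
  forall eta, (0 < eta)%R ->
    \forall x \near F, (l - eta)%:E <= f x <= (l + eta)%:E.
Proof.
move=> /fine_cvgP[ffin fl] eta eta0.
have : \forall x \near F, (`|l - fine (f x)| <= eta)%R.
  exact: (cvgr_dist_le _ _ fl).
apply: filterS2 ffin => x fx; rewrite ler_distlC => /andP[lf fl'].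
by rewrite -(fineK fx) !lee_fin lf.
Qed.

(** No finiteness has to be supplied: the bounds for eta = 1 already make f eventually finite. *)
Lemma near_cvg_EFin (T : Type) (F : set_system T) {FF : Filter F}
    (f : T -> \bar R) (l : R) :
  (forall eta, (0 < eta)%R ->
    \forall x \near F, (l - eta)%:E <= f x <= (l + eta)%:E) ->
  f @ F --> l%:E.
Proof.
move=> fl; apply/fine_cvgP; split.
  apply: filterS (fl 1%R ltr01) => x /andP[lf fl'].
  exact: fin_num_between lf fl'.
apply/cvgrPdist_le => eta eta0; apply: filterS (fl _ eta0) => x /andP[lf fl'].
have fx : f x \is a fin_num.
  exact: fin_num_between lf fl'.
by move: lf fl'; rewrite -(fineK fx) !lee_fin /= ler_distlC => -> ->.
Qed.

(** Half of eta goes to each limit. The threshold r0 depends on eta only, while the range of e may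
    depend on r. *)
Lemma iterated_lim_near (f : R -> R -> \bar R) (l : R) : iterated_lim f l%:E ->
  forall eta, (0 < eta)%R -> exists r0 : R, forall r, (r0 < r)%R ->
    \forall e \near (0 : R)^'+, (l - eta)%:E <= f r e <= (l + eta)%:E.
Proof.
move=> [L [fL Ll]] eta eta0; have eta20 : (0 < eta / 2)%R by rewrite divr_gt0.
have := filterI fL (cvg_EFin_near Ll eta20).
move=> [r0 [_ r0P]]; exists r0 => r /r0P[frL /andP[lL Ll']].
have Lfin : L r \is a fin_num.
  exact: fin_num_between lL Ll'.
move: frL; rewrite -(fineK Lfin) => /cvg_EFin_near/(_ _ eta20).
move: lL Ll'; rewrite -(fineK Lfin) !lee_fin => lL Ll'.
apply: filterS => e /andP[Lf fL']; apply/andP; split.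
  by apply: le_trans Lf; rewrite lee_fin; lra.
by apply: (le_trans fL'); rewrite lee_fin; lra.
Qed.

End limits.
Unset Implicit Arguments.

Theorem theorem3p1 (R : realType) (p s : R) (N : nat)
  (hp : (1 <= p)%R) (hs0 : (0 < s)%R) (hs1 : (s < 1)%R) (hN : (0 < N)%N)
  (rho : R -> 'rV[R]_N -> R)
  (mrho : forall e : R, (0 < e)%R -> lebesgue_measurable_fun (rho e))
  (rho0 : forall (e : R) (z : 'rV[R]_N), (0 < e)%R -> (0 <= rho e z)%R)
  (hmass : iterated_lim (fun r e : R =>
     \int[lebesgue_rV R N]_(z in [set z | (enorm z > r)%R]) (rho e z)%:E) 1)
  (hconc : iterated_lim (fun r e : R =>
     \int[lebesgue_rV R N]_(z in [set z | (enorm z < r)%R])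
       (enorm z `^ (s * p) * rho e z)%:E) 0) :
  (forall u, Wsp s p u ->
    nonlocal_energy p (rho e) u @[e --> (0 : R)^'+] -->
      2%:E * 'N[lebesgue_rV R N]_p%:E[EFin \o u] `^ p) /\
  (forall u, Wsp s p u -> forall r : R, (0 < r)%R ->
    \int[lebesgue_rV R N]_(z in [set z | (enorm z < r)%R])
      \int[lebesgue_rV R N]_x (rho e z * `|u (x + z) - u x| `^ p)%:E
      @[e --> (0 : R)^'+] --> 0).
Proof.
have rho_e0 (e : R) : (0 < e)%R -> forall z, (0 <= rho e z)%R.
  by move=> e0 z; exact: rho0.
have e_gt0 : \forall e \near (0 : R)^'+, (0 < e)%R by exact: nbhs_right_gt.
have near0 eta : (0 < eta)%R -> exists r0 : R, forall r, (r0 < r)%R ->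
    \forall e \near (0 : R)^'+, near_moment s p (rho e) r <= eta%:E.
  move=> eta0; have [r0 r0P] := iterated_lim_near hconc eta0.
  by exists r0 => r /r0P; apply: filterS => e /andP[_]; rewrite add0r.
split=> u Wu; have [K K0 [Knear Kfar]] := energy_bounds hp hs0 Wu; last first.
  move=> r r_gt0; apply: near_cvg_EFin => eta eta0.
  (* K may be 0, so eta is divided by K + 1. *)
  have K10 : (0 < K + 1)%R by rewrite ltr_wpDl.
  have [r0 r0P] := near0 (eta / (K + 1))%R (divr_gt0 eta0 K10).
  (* The given r may lie below the threshold r0; enlarging the ball of the moment repairs this. *)
  have r0r' : (r0 < Num.max r (r0 + 1))%R by rewrite lt_max ltrDl ltr01 orbT.
  apply: filterS2 e_gt0 (r0P _ r0r') => e e0 Ce.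
  apply/andP; split.
    apply: (@le_trans _ _ 0); first by rewrite lee_fin sub0r oppr_le0 ltW.
    apply: integral_ge0 => z _; apply: integral_ge0 => x _.
    by rewrite lee_fin mulr_ge0 ?powR_ge0// rho0.
  have rr' : (r <= Num.max r (r0 + 1))%R by rewrite le_max lexx.
  apply: le_trans (Knear _ _ _ (mrho e e0) (rho_e0 e e0) rr') _.
  apply: (@le_trans _ _ (K%:E * (eta / (K + 1))%:E)).
    by apply: lee_wpmul2l; rewrite ?lee_fin.
  rewrite -EFinM lee_fin add0r mulrCA ler_piMr ?(ltW eta0)//.
  by rewrite ler_pdivrMr// mul1r lerDl.
have [u' [_ _ _ Nfin _]] := Wsp_borel hp hs0 Wu.
rewrite -(fineK Nfin) -EFinM.
set A := (2 * fine _)%R.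
have A0 : (0 <= A)%R by rewrite mulr_ge0// fine_ge0// poweR_ge0.
apply: near_cvg_EFin => eta eta0.
have AK0 : (0 < A + K + 2)%R by lra.
(* With eta1 <= 1, the upper bound (A + eta1)(1 + eta1) + K eta1 is at most A + eta1 (A + K + 2),
   hence at most A + eta; the lower bound loses no more. *)
pose eta1 := Num.min 1%R (eta / (A + K + 2))%R.
have eta10 : (0 < eta1)%R by rewrite lt_min ltr01 divr_gt0.
have eta1le1 : (eta1 <= 1)%R by rewrite ge_min lexx.
have eta1le : (eta1 * (A + K + 2) <= eta)%R.
  by rewrite -ler_pdivlMr// ge_min lexx orbT.
have [r0 r0P] := Kfar eta1 eta10.
have [r1 r1P] := near0 eta1 eta10.
have [r2 r2P] := iterated_lim_near hmass eta10.
(* A single radius beyond all three thresholds, fixed before e is taken small. *)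
pose r := (Num.max r0 (Num.max r1 r2) + 1)%R.
have mr : (Num.max r0 (Num.max r1 r2) < r)%R by rewrite ltrDl.
have r0r : (r0 < r)%R by apply: le_lt_trans mr; rewrite le_max lexx.
have r1r : (r1 < r + 1)%R.
  apply: (@lt_trans _ _ r); last by rewrite ltrDl.
  by apply: le_lt_trans mr; rewrite !le_max lexx orbT.
have r2r : (r2 < r)%R by apply: le_lt_trans mr; rewrite !le_max lexx !orbT.
near=> e.
have e0 : (0 < e)%R by near: e; exact: nbhs_right_gt.
have Ce : near_moment s p (rho e) (r + 1) <= eta1%:E by near: e; exact: r1P.
have /andP[Ml Mu] : (1 - eta1)%:E <= far_mass (rho e) r <= (1 + eta1)%:E.
  by near: e; exact: r2P.
have [Fl Fu] := r0P (rho e) r (mrho e e0) (rho_e0 e e0) r0r.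
rewrite -/A in Fl Fu.
apply/andP; split.
  have [Aeta|Aeta] := leP (A - eta1)%R 0%R.
    apply: (@le_trans _ _ 0); last first.
      by apply: integral_ge0 => xy _; rewrite lee_fin mulr_ge0 ?powR_ge0// rho0.
    by rewrite lee_fin; nra.
  apply: le_trans Fl; apply: (@le_trans _ _ ((A - eta1)%:E * (1 - eta1)%:E)).
    by rewrite -EFinM lee_fin; nra.
  by apply: lee_wpmul2l; rewrite ?lee_fin// ltW.
apply: le_trans Fu _.
apply: (@le_trans _ _ ((A + eta1)%:E * (1 + eta1)%:E + K%:E * eta1%:E)).
  by apply: leeD; apply: lee_wpmul2l; rewrite ?lee_fin//; lra.
by rewrite -!EFinM -EFinD lee_fin; nra.
Unshelve. all: by end_near.
Qed.
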